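(* Let $\Pi$ be a program which, syntactically, belongs to both $\mathcal{S}log$ and $\mathcal{S}log^+$ (as described in the context), and let $A$ be a set of ground regular atoms. Then $A$ is an $\mathcal{S}log$ answer set of $\Pi$ if and only if $A$ is an $\mathcal{S}log^+$ answer set of $\Pi$.
   Context: **Common syntax.** A (ground) program belonging syntactically to both languages is a collection of rules $$a\leftarrow b_1,\dots,b_m,\ not\ c_1,\dots,not\ c_n,\ C_1,\dots,C_k$$ with finite bodies, where $a$, $b_i$, $c_j$ are ground atoms $p(\bar t)$ over a signature $\Sigma$ (no disjunction, no classical negation), and each $C_i$ is an aggregate atom $f\{X:p(\dots)\}\odot k$. Here $\{X:p(\dots)\}$ is a set name whose condition is a single atom with $X$ as its only variable (no multisets), $k$ is a number, $\odot\in\{>,\ge,<,\le,=,\ne\}$, and $f$ denotes a (possibly partial) function from sets of ground terms to integers. For an aggregate atom $C$ with set name $\{X:p(\dots)\}$ write $p(t)$ for the ground instance of its condition with $X$ replaced by the ground term $t$, and $base(C)$ for the set of all such ground instances. Infinite sets are excluded: $base(C)$ is finite for every aggregate atom $C$ of the program. **Satisfaction.** For a set $I$ of ground atoms, an aggregate atom $C = f\{X:p(X)\}\odot k$ is undefined in $I$ if $f$ is undefined on $\{t:p(t)\in I\}$; otherwise it is true or false in $I$ according to whether $f(\{t:p(t)\in I\})\odot k$ holds. $I$ satisfies $C$ ($I\models C$) iff $C$ is true in $I$. **$\mathcal{S}log$ answer sets (Son–Pontelli semantics).** A solution of an aggregate atom $C$ is a pair $\langle S_1,S_2\rangle$ of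 disjoint subsets of $base(C)$ such that every set $I$ of ground atoms with $S_1\subseteq I$ and $S_2\cap I=\emptyset$ satisfies $C$. For sets $I,M$ of ground atoms, $C$ is conditionally satisfied with respect to $(I,M)$ if $\langle I\cap M\cap base(C),\ base(C)\setminus M\rangle$ is a solution of $C$. Let ${}^M\Pi$ be obtained from $\Pi$ by deleting each rule containing $not\ c$ with $c\in M$ and deleting all remaining expressions $not\ c$ (aggregate atoms are kept). Define the monotone operator $$K_M(I)=\{a : (a\leftarrow b_1,\dots,b_m,C_1,\dots,C_k)\in{}^M\Pi,\ b_1,\dots,b_m\in I,\ \text{each } C_i \text{ is conditionally satisfied w.r.t. } (I,M)\}.$$ $M$ is an $\mathcal{S}log$ answer set of $\Pi$ iff $M$ is the least fixpoint of $K_M$. **$\mathcal{S}log^+$ answer sets (for programs of this form).** Let $A$ be a set of ground atoms. A set $W$ is a minimal support for an aggregate atom $C$ in $A$ if: (i) $W\subseteq A$; (ii) every $V$ with $W\subseteq V\subseteq A$ satisfies $C$; (iii) no proper subset $U\subsetneq W$ satisfies (i) and (ii). An $\mathcal{S}log^+$ set reduct of $\Pi$ with respect to $A$ is any program obtained from $\Pi$ by (1) removing rules containing aggregate atoms that are false or undefined in $A$; (2) replacing every remaining occurrence of an aggregate atom in the body of a rule by (the elements of) one of its minimal supports in $A$, the choices being made independently. Such a reduct contains no aggregates. $A$ is an $\mathcal{S}log^+$ answer set of $\Pi$ iff $A$ is an answer set (stable model in the sense of Gelfond and Lifschitz) of some $\mathcal{S}log^+$ set reduct of $\Pi$ with respect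 to $A$: that is, $A$ is the least set of atoms satisfying all the rules obtained from the reduct by deleting each rule containing $not\ c$ with $c\in A$ and deleting all remaining expressions $not\ c$. *)

(* Defs.v *)
From mathcomp Require Import all_boot all_order all_algebra.
From mathcomp Require Import all_classical.

Set Implicit Arguments.
Unset Strict Implicit.
Unset Printing Implicit Defensive.

Import Order.TTheory GRing.Theory Num.Theory.
Local Open Scope classical_set_scope.

Record signature : Type := Signature {
  fsym : Type;
  farity : fsym -> nat;
  psym : Type;
  parity : psym -> nat }.

(* Terms with variables in [V]: ground terms are the case [V = void], and
   [V = unit] gives the terms whose only possible variable is X. *)
Inductive term (Sg : signature) (V : Type) : Type :=
| Var (x : V)
| App (f : fsym Sg) (args : 'I_(farity f) -> term Sg V).

Fixpoint tsubst (Sg : signature) (V W : Type) (s : V -> term Sg W)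
    (u : term Sg V) : term Sg W :=
  match u with
  | Var x => s x
  | App f args => App (fun i => tsubst s (args i))
  end.

Fixpoint occurs (Sg : signature) (V : Type) (x : V) (u : term Sg V) : Prop :=
  match u with
  | Var y => y = x
  | App f args => exists i, occurs x (args i)
  end.

Record atom (Sg : signature) (V : Type) : Type := Atom {
  apred : psym Sg;
  aargs : 'I_(parity apred) -> term Sg V }.

Definition gterm (Sg : signature) : Type := term Sg void.
Definition gatom (Sg : signature) : Type := atom Sg void.

Inductive cmp : Type := CGt | CGe | CLt | CLe | CEq | CNe.

Definition cmp_holds (o : cmp) (x y : int) : bool :=
  match o with
  | CGt => (x > y)%R
  | CGe => (x >= y)%R
  | CLt => (x < y)%R
  | CLe => (x <= y)%R
  | CEq => x == y
  | CNe => x != y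
  end.

(* The aggregate atom f{X : cond} op k. The field [afun] is the function f
   itself, with value [None] where f is undefined. *)
Record aggregate (Sg : signature) : Type := Aggregate {
  afun : set (gterm Sg) -> option int;
  acond : atom Sg unit;
  aop : cmp;
  abound : int }.

Definition cond_inst (Sg : signature) (C : aggregate Sg) (t : gterm Sg) :
    gatom Sg :=
  Atom (fun i => tsubst (fun=> t) (@aargs _ _ (acond C) i)).

Definition base (Sg : signature) (C : aggregate Sg) : set (gatom Sg) :=
  range (cond_inst C).

Definition X_occurs (Sg : signature) (C : aggregate Sg) : Prop :=
  exists i, occurs tt (@aargs _ _ (acond C) i).

(* [raggs] is a sequence because repeated occurrences of an aggregate atom in
   one body are treated separately by the set reduct below. *)
Record rule (Sg : signature) : Type := Rule {
  rhead : gatom Sg;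
  rpos : set (gatom Sg);
  rneg : set (gatom Sg);
  raggs : seq (aggregate Sg) }.

Definition agg_occ (Sg : signature) (r : rule Sg) : Type := 'I_(size (raggs r)).

Definition agg_at (Sg : signature) (r : rule Sg) (i : agg_occ r) :
    aggregate Sg :=
  tnth (in_tuple (raggs r)) i.

Definition program (Sg : signature) : Type := set (rule Sg).

Definition common_program (Sg : signature) (P : program Sg) : Prop :=
  forall r, P r ->
    [/\ finite_set (rpos r), finite_set (rneg r) &
        forall i : agg_occ r,
          X_occurs (agg_at i) /\ finite_set (base (agg_at i))].

Definition agg_value (Sg : signature) (I : set (gatom Sg)) (C : aggregate Sg) :
    option bool :=
  omap (fun z => cmp_holds (aop C) z (abound C))
       (afun C [set t | I (cond_inst C t)]).

Definition agg_undefined (Sg : signature) (I : set (gatom Sg))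
    (C : aggregate Sg) : Prop := agg_value I C = None.
Definition agg_false (Sg : signature) (I : set (gatom Sg))
    (C : aggregate Sg) : Prop := agg_value I C = Some false.
Definition agg_sat (Sg : signature) (I : set (gatom Sg))
    (C : aggregate Sg) : Prop := agg_value I C = Some true.

Definition rule_sat (Sg : signature) (I : set (gatom Sg)) (r : rule Sg) :
    Prop :=
  rpos r `<=` I -> rneg r `&` I = set0 ->
  (forall i : agg_occ r, agg_sat I (agg_at i)) -> I (rhead r).

(* The Gelfond-Lifschitz transformation; aggregate atoms are kept. *)
Definition gl_reduct (Sg : signature) (M : set (gatom Sg)) (P : program Sg) :
    program Sg :=
  [set Rule (rhead r) (rpos r) set0 (raggs r) |
     r in [set r | P r /\ rneg r `&` M = set0]].

(* Only used on programs without aggregate atoms. *)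
Definition gl_answer_set (Sg : signature) (P : program Sg)
    (A : set (gatom Sg)) : Prop :=
  let model (I : set (gatom Sg)) := forall r, gl_reduct A P r -> rule_sat I r in
  model A /\ forall I, model I -> A `<=` I.

Definition solution (Sg : signature) (C : aggregate Sg)
    (S1 S2 : set (gatom Sg)) : Prop :=
  [/\ S1 `<=` base C, S2 `<=` base C, S1 `&` S2 = set0 &
      forall I : set (gatom Sg), S1 `<=` I -> S2 `&` I = set0 -> agg_sat I C].

Definition cond_sat (Sg : signature) (I M : set (gatom Sg))
    (C : aggregate Sg) : Prop :=
  solution C (I `&` M `&` base C) (base C `\` M).

Definition slog_op (Sg : signature) (P : program Sg) (M I : set (gatom Sg)) :
    set (gatom Sg) :=
  [set a | exists r, [/\ gl_reduct M P r, rhead r = a, rpos r `<=` I &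
                         forall i : agg_occ r, cond_sat I M (agg_at i)]].

Definition least_fixpoint (T : Type) (F : set T -> set T) (M : set T) : Prop :=
  F M = M /\ forall I, F I = I -> M `<=` I.

Definition slog_answer_set (Sg : signature) (P : program Sg)
    (M : set (gatom Sg)) : Prop :=
  least_fixpoint (slog_op P M) M.

Definition agg_support (Sg : signature) (A : set (gatom Sg)) (C : aggregate Sg)
    (W : set (gatom Sg)) : Prop :=
  W `<=` A /\ forall V : set (gatom Sg), W `<=` V -> V `<=` A -> agg_sat V C.

Definition minimal_support (Sg : signature) (A : set (gatom Sg))
    (C : aggregate Sg) (W : set (gatom Sg)) : Prop :=
  agg_support A C W /\
  forall U : set (gatom Sg), U `<` W -> ~ agg_support A C U.

Definition remaining (Sg : signature) (P : program Sg) (A : set (gatom Sg)) :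
    program Sg :=
  [set r | P r /\ ~ exists i : agg_occ r,
                      agg_false A (agg_at i) \/ agg_undefined A (agg_at i)].

(* [W r i] is the support chosen for the [i]-th aggregate occurrence of [r]. *)
Definition set_reduct (Sg : signature) (P : program Sg) (A : set (gatom Sg))
    (R : program Sg) : Prop :=
  exists W : forall r : rule Sg, agg_occ r -> set (gatom Sg),
    (forall r, remaining P A r ->
       forall i : agg_occ r, minimal_support A (agg_at i) (W r i)) /\
    R = [set Rule (rhead r) (rpos r `|` \bigcup_i W r i) (rneg r) [::] |
           r in remaining P A].

Definition slog_plus_answer_set (Sg : signature) (P : program Sg)
    (A : set (gatom Sg)) : Prop :=
  exists R, set_reduct P A R /\ gl_answer_set R A.

(* Main.v *)
Require Import Defs.
From mathcomp Require Import all_boot all_order all_algebra.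
From mathcomp Require Import all_classical.
From mathcomp Require Import finmap.

Local Open Scope classical_set_scope.

(** Conditional satisfaction of [C] with respect to [(I, A)] says exactly that
    [I `&` A] supports [C] in [A], so the two semantics differ only in that the
    set reduct commits to one support per aggregate occurrence in advance.
    If [A] is the least fixpoint of [K_A], it is the union of the stages
    [K_A^n(set0)], because bodies and bases are finite; choosing for each rule
    minimal supports inside the first stage at which the rule fires makes [A]
    the least model of the resulting reduct. Conversely, for any
    choice of supports and every prefixpoint [I] of [K_A], the set [I `&` A] is
    a model of the reduct, because a subset of [A] containing a support is a
    support; this forces [A `<=` I]. *)

(** * Finite sets: minimal subsets and increasing chains *)

Lemma finite_set_minimal {T : Type} {Q : set T -> Prop} {S : set T} :
  finite_set S -> Q S ->
  exists W, [/\ W `<=` S, Q W & forall U, U `<` W -> ~ Q U].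
Proof.
(* A choice structure on [T] turns finite sets into [fset]s, whose cardinality drives the induction:
   either [X] is already minimal or a proper subset satisfying [Q] takes its place. *)
elim/Pchoice: T => T in Q S *.
move=> /finite_fsetP[X ->].
have [n leXn] := ubnP #|` X|; elim: n => // n IHn in X leXn *.
move=> QX; have [[U [ltUX QU]]|noU] :=
  pselect (exists U, U `<` [set` X] /\ Q U); last first.
  by exists [set` X]; split=> // U ltUX QU; apply: noU; exists U.
have /finite_fsetP[Y defU] : finite_set U.
  exact: sub_finite_set (properW ltUX) _.
rewrite {U}defU in ltUX QU.
have ltYX : (Y `<` X)%fset.
  rewrite fproperE; case: ltUX => YX XY; apply/andP; split.
    by apply/fsubsetP => x; exact: YX.
  by apply/negP => /fsubsetP.
have [|//|W [WY QW Wmin]] := IHn Y.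
  exact: (leq_trans (fproper_ltn_card ltYX)).
by exists W; split=> // x /WY; exact: ltUX.1.
Qed.

(** Compactness: each element enters at some index, and the maximum of finitely many indices works
    for all. This is how finite bodies and bases make the stages close up at omega. *)
Lemma finite_sub_chain {T : Type} {c : nat -> set T} {F : set T} :
  {homo c : m n / m <= n >-> m `<=` n} -> finite_set F ->
  F `<=` \bigcup_n c n -> exists n, F `<=` c n.
Proof.
elim/Pchoice: T => T in c F *.
move=> c_homo /finite_seqP[s ->]; elim: s => [|x s IHs] sub; first by exists 0.
have [|m sm] := IHs; first by move=> y ys; apply: sub; rewrite /= inE ys orbT.
have [|n _ xn] := sub x; first by rewrite /= inE eqxx.
exists (maxn m n) => y; rewrite /= inE => /orP[/eqP->|ys].
  exact: c_homo (leq_maxr m n) _ xn.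
exact: c_homo (leq_maxl m n) _ (sm y ys).
Qed.

(** * Supports of aggregate atoms and conditional satisfaction *)

Lemma agg_sat_base {Sg : signature} {C : aggregate Sg} {I J : set (gatom Sg)} :
  I `&` base C = J `&` base C -> agg_sat I C = agg_sat J C.
Proof.
move=> eqIJ; rewrite /agg_sat /agg_value.
suff -> : [set t | I (cond_inst C t)] = [set t | J (cond_inst C t)] by [].
have inB t : base C (cond_inst C t) by exists t.
apply/seteqP; split=> t /= h.
  by have [] : (J `&` base C) (cond_inst C t) by rewrite -eqIJ; split.
by have [] : (I `&` base C) (cond_inst C t) by rewrite eqIJ; split.
Qed.

Lemma agg_satP {Sg : signature} {A : set (gatom Sg)} {C : aggregate Sg} :
  agg_sat A C <-> ~ (agg_false A C \/ agg_undefined A C).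
Proof.
rewrite /agg_sat /agg_false /agg_undefined.
case: (agg_value A C) => [[]|]; split=> //.
- by move=> _ [].
- by case; left.
- by case; right.
Qed.

(** If [V] contains the part of [S] in the base, then [V] and its union with [S] agree on the base,
    and that union lies between [S] and [A]. Supports can thus be cut down to finite sets when the
    base is finite. *)
Lemma agg_support_base {Sg : signature} {A : set (gatom Sg)}
    {C : aggregate Sg} {S : set (gatom Sg)} :
  agg_support A C S -> agg_support A C (S `&` base C).
Proof.
move=> [SA Ssat]; split=> [x [/SA]//|V SV VA].
have <- : agg_sat (V `|` S) C = agg_sat V C.
  apply: agg_sat_base; rewrite setIUl; apply/setUidPl => x [Sx Bx].
  by split=> //; exact: SV.
by apply: Ssat => [x|x [/VA|/SA]//]; right.
Qed.

Lemma agg_supportS {Sg : signature} {A : set (gatom Sg)} {C : aggregate Sg}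
    {S S' : set (gatom Sg)} :
  S `<=` S' -> S' `<=` A -> agg_support A C S -> agg_support A C S'.
Proof.
move=> SS' S'A [_ Ssat]; split=> // V S'V; apply: Ssat.
exact: subset_trans S'V.
Qed.

Lemma agg_support_sat {Sg : signature} {A : set (gatom Sg)} {C : aggregate Sg}
    {S : set (gatom Sg)} :
  agg_support A C S -> agg_sat A C.
Proof. by move=> [SA]; apply. Qed.

Lemma agg_support_self {Sg : signature} {A : set (gatom Sg)}
    {C : aggregate Sg} :
  agg_sat A C -> agg_support A C A.
Proof.
by move=> satA; split=> // V AV VA; have -> : V = A by apply/seteqP.
Qed.

Lemma minimal_support_exists {Sg : signature} {A : set (gatom Sg)}
    {C : aggregate Sg} {S : set (gatom Sg)} :
  finite_set (base C) -> agg_support A C S ->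
  exists2 W, minimal_support A C W & W `<=` S.
Proof.
move=> finB /agg_support_base supS.
have [W [WS supW minW]] :=
  finite_set_minimal (finite_setIr S finB) supS.
by exists W => // x /WS[].
Qed.

Lemma cond_satE {Sg : signature} {I A : set (gatom Sg)} {C : aggregate Sg} :
  cond_sat I A C <-> agg_support A C (I `&` A).
Proof.
split=> [[_ _ _ sat]|[_ sat]].
  split=> [x []//|V IV VA]; apply: sat => [x [IAx _]|]; first exact: IV.
  by rewrite -subset0 => x [[_ nAx] /VA].
split=> [x []//|x []//||J SJ BJ].
  by rewrite -subset0 => x [[[_ Ax] _] [_ nAx]].
have BJA x : base C x -> J x -> A x.
  move=> Bx Jx; apply: contrapT => nAx.
  by have : set0 x by rewrite -BJ.
have <- : agg_sat ((J `&` base C) `|` (I `&` A)) C = agg_sat J C.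
  apply: agg_sat_base; apply/seteqP; split=> x.
    by move=> [[[]//|IAx] Bx]; split=> //; apply: SJ.
  by move=> [Jx Bx]; split=> //; left.
apply: sat => [x|x [[Jx Bx]|[]//]]; first by right.
exact: BJA.
Qed.

(** * The operator [K_A] and its finite stages *)

Lemma slog_opP {Sg : signature} {P : program Sg} {A I : set (gatom Sg)}
    {a : gatom Sg} :
  slog_op P A I a <->
  exists r, [/\ P r, rneg r `&` A = set0, rhead r = a, rpos r `<=` I &
                forall i : agg_occ r, agg_support A (agg_at i) (I `&` A)].
Proof.
split=> [[_ [[r [Pr negr] <-] /= <- posr aggr]]|[r [Pr negr <- posr aggr]]].
  by exists r; split=> // i; apply/cond_satE; exact: aggr.
exists (Rule (rhead r) (rpos r) set0 (raggs r)); split=> //; first by exists r.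
by move=> i; apply/cond_satE; exact: aggr.
Qed.

Lemma slog_op_mono {Sg : signature} {P : program Sg}
    {A I J : set (gatom Sg)} :
  I `<=` J -> slog_op P A I `<=` slog_op P A J.
Proof.
move=> IJ a /slog_opP[r [Pr negr ha posr aggr]].
apply/slog_opP; exists r; split=> // [|i]; first exact: subset_trans IJ.
by apply: agg_supportS (aggr i) => [x [/IJ]|x []].
Qed.

Definition stage {Sg : signature} (P : program Sg) (A : set (gatom Sg))
    (n : nat) : set (gatom Sg) :=
  iter n (slog_op P A) set0.

Lemma stage_homo {Sg : signature} (P : program Sg) (A : set (gatom Sg)) :
  {homo stage P A : m n / m <= n >-> m `<=` n}.
Proof.
apply: (@homo_leq _ _ subset) => [I|J I K|n].
- exact: subset_refl.
- exact: subset_trans.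
- elim: n => [|n IHn]; first exact: sub0set.
  exact: slog_op_mono.
Qed.

Lemma bigcup_stage_fixpoint {Sg : signature} {P : program Sg}
    {A : set (gatom Sg)} :
  common_program P ->
  slog_op P A (\bigcup_n stage P A n) = \bigcup_n stage P A n.
Proof.
move=> hP; apply/seteqP; split=> [a|a [n _]]; last first.
  case: n => // n an; apply: slog_op_mono an => x xn; by exists n.
move=> /slog_opP[r [Pr negr ha posr aggr]].
have [finpos _ finagg] := hP r Pr.
have [m posm] := finite_sub_chain (stage_homo P A) finpos posr.
(* Only the base part of the support matters; being finite, it is already contained in one stage. *)
have supp (i : agg_occ r) :
    exists n, agg_support A (agg_at i) (stage P A n `&` A).
  have /agg_support_base supU := aggr i.
  have [||n subn] := finite_sub_chain (stage_homo P A)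
    (F := (\bigcup_n stage P A n) `&` A `&` base (agg_at i)).
  - by apply: finite_setIr; have [] := finagg i.
  - by move=> x [[]].
  exists n; apply: agg_supportS supU => [x Sx|x []//].
  by split; [exact: subn | case: Sx => -[]].
have [k suppk] := choice supp.
(* A stage late enough for the positive body and for all of the finitely many aggregate occurrences;
   the rule then fires at the next one. *)
pose N := maxn m (\max_i k i).
exists N.+1 => //; apply/slog_opP; exists r; split=> // [x /posm|i].
  exact: stage_homo (leq_maxl _ _) _.
apply: agg_supportS (suppk i) => [x [kx Ax]|x []//]; split=> //.
apply: stage_homo kx; apply: leq_trans (leq_maxr _ _).
exact: (leq_bigmax i).
Qed.

(** * Set reducts, their models and the choice of supports *)

Definition reduct_of {Sg : signature} (P : program Sg) (A : set (gatom Sg))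
    (W : forall r : rule Sg, agg_occ r -> set (gatom Sg)) : program Sg :=
  [set Rule (rhead r) (rpos r `|` \bigcup_i W r i) (rneg r) [::] |
     r in remaining P A].

Lemma remainingP {Sg : signature} {P : program Sg} {A : set (gatom Sg)}
    {r : rule Sg} :
  remaining P A r <-> P r /\ forall i : agg_occ r, agg_sat A (agg_at i).
Proof.
split=> -[Pr aggr]; split=> //.
  by move=> i; apply/agg_satP => bad; apply: aggr; exists i.
by move=> [i bad]; have /agg_satP := aggr i.
Qed.

Lemma reduct_of_modelP {Sg : signature} {P : program Sg} {A : set (gatom Sg)}
    {W : forall r : rule Sg, agg_occ r -> set (gatom Sg)}
    {I : set (gatom Sg)} :
  (forall r, gl_reduct A (reduct_of P A W) r -> rule_sat I r) <->
  (forall r, remaining P A r -> rneg r `&` A = set0 -> rpos r `<=` I ->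
     (forall i, W r i `<=` I) -> I (rhead r)).
Proof.
split=> model.
  move=> r remr negr posr Wr.
  apply: (model (Rule (rhead r) (rpos r `|` \bigcup_i W r i) set0 [::])).
  - by exists (Rule (rhead r) (rpos r `|` \bigcup_i W r i) (rneg r) [::]);
      split=> //; exists r.
  - by move=> x [/posr|[i _ /Wr]].
  - exact: set0I.
  - by case.
move=> _ [_ [[r remr <-] negr] <-] posr _ _ /=.
by apply: model => // [x rx|i x Wx]; apply: posr; [left|right; exists i].
Qed.

(** Each aggregate of a remaining rule is true in [A], hence supported by [A] itself, so [K_A]
    applied to [A] yields the head. *)
Lemma remaining_head {Sg : signature} {P : program Sg} {A : set (gatom Sg)}
    {r : rule Sg} :
  slog_op P A A `<=` A -> remaining P A r -> rneg r `&` A = set0 ->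
  rpos r `<=` A -> A (rhead r).
Proof.
move=> KA /remainingP[Pr satr] negr posr.
apply: KA; apply/slog_opP; exists r; split=> // i.
by rewrite setIid; exact: agg_support_self.
Qed.

(** Since stages increase, supports taken inside the first stage at which the rule fires lie in
    every stage at which it fires. The premise [remaining] stands under the existential so that a
    choice can be extracted for all rules at once. *)
Lemma early_supports_exist {Sg : signature} {P : program Sg}
    (A : set (gatom Sg)) (r : rule Sg) :
  common_program P ->
  exists W : agg_occ r -> set (gatom Sg),
    remaining P A r ->
    (forall i, minimal_support A (agg_at i) (W i)) /\
    forall n, (forall i : agg_occ r,
                 agg_support A (agg_at i) (stage P A n `&` A)) ->
      forall i, W i `<=` stage P A n.
Proof.
move=> hP; have [/remainingP[Pr satr]|nrem] := pselect (remaining P A r);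
  last by exists (fun=> set0).
have [_ _ finagg] := hP r Pr.
pose fires n := forall i : agg_occ r,
  agg_support A (agg_at i) (stage P A n `&` A).
(* [S] is the first firing stage intersected with [A]; if the rule never fires, the second condition
   is vacuous and [A] itself serves. *)
have [S supS Sn] : exists2 S, forall i : agg_occ r, agg_support A (agg_at i) S
    & forall n, fires n -> S `<=` stage P A n.
  have [exn|nofire] := pselect (exists n, `[< fires n >]); last first.
    exists A => [i|n fn]; first exact: agg_support_self.
    by case: nofire; exists n; apply/asboolP.
  case: (ex_minnP exn) => m /asboolP fm minm.
  exists (stage P A m `&` A) => // n fn x [mx _].
  by apply: stage_homo mx; apply: minm; apply/asboolP.
have /choice[W WP] (i : agg_occ r) : exists W,
    minimal_support A (agg_at i) W /\ W `<=` S.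
  have [W] := minimal_support_exists (finagg i).2 (supS i).
  by exists W.
exists W => _; split=> [i|n fn i]; first exact: (WP i).1.
exact: subset_trans (WP i).2 (Sn n fn).
Qed.

(** * The two implications *)

Lemma slog_plus_of_slog {Sg : signature} {P : program Sg}
    {A : set (gatom Sg)} :
  common_program P -> slog_answer_set P A -> slog_plus_answer_set P A.
Proof.
move=> hP [KA leastA].
have AU : A `<=` \bigcup_n stage P A n.
  by apply: leastA; exact: bigcup_stage_fixpoint.
pose W r := sval (cid (early_supports_exist A r hP)).
have WP r : remaining P A r -> _ := svalP (cid (early_supports_exist A r hP)).
exists (reduct_of P A W); split; first by exists W; split=> // r /WP[].
split=> [|I /reduct_of_modelP model].
  apply/reduct_of_modelP => r remr negr posr _.
  by apply: remaining_head remr negr posr; rewrite KA; exact: subset_refl.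
(* By induction every stage lies in every model of the reduct: a rule that fires from a stage has
   its chosen supports inside that stage. *)
suff stageI n : stage P A n `<=` I by move=> a /AU[n _ /stageI].
elim: n => [|n IHn]; first exact: sub0set.
move=> _ /slog_opP[r [Pr negr <- posr aggr]].
have remr : remaining P A r.
  by apply/remainingP; split=> // i; exact: agg_support_sat (aggr i).
apply: model => //; first exact: subset_trans IHn.
by move=> i; apply: subset_trans IHn; exact: (WP r remr).2.
Qed.

Lemma slog_of_slog_plus {Sg : signature} {P : program Sg}
    {A : set (gatom Sg)} :
  slog_plus_answer_set P A -> slog_answer_set P A.
Proof.
move=> [_ [[W [minW ->]] [/reduct_of_modelP modelA leastA]]].
have KA : slog_op P A A `<=` A.
  move=> _ /slog_opP[r [Pr negr <- posr aggr]].
  have remr : remaining P A r.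
    by apply/remainingP; split=> // i; exact: agg_support_sat (aggr i).
  by apply: modelA => // i; have [[]] := minW r remr i.
have prefix I : slog_op P A I `<=` I -> A `<=` I.
  (* Passing to the intersection with [A] keeps the sets between a chosen support and [A], the only
     range where supports control satisfaction. *)
  move=> KI; suff : A `<=` I `&` A by move=> AIA x /AIA[].
  apply: leastA; apply/reduct_of_modelP => r remr negr posr Wr.
  have [Pr _] := remr; split; last first.
    by apply: (remaining_head KA remr) => // x /posr[].
  apply: KI; apply/slog_opP; exists r; split=> // [x /posr[]//|i].
  by apply: agg_supportS (minW r remr i).1 => [|x []].
split=> [|I KI]; last by apply: prefix; rewrite KI.
(* As in Knaster-Tarski, monotonicity makes [slog_op P A A] a prefixpoint, so it contains [A]. *)
by apply/seteqP; split=> //; apply: prefix; exact: slog_op_mono.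
Qed.

Theorem theorem2 (Sg : signature) (P : program Sg) (A : set (gatom Sg))
    (hP : common_program P) :
  slog_answer_set P A <-> slog_plus_answer_set P A.
Proof. by split; [exact: slog_plus_of_slog | exact: slog_of_slog_plus]. Qed.
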